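(* Let $\delta\in(0,1]$ and let $v_1,\ldots,v_n\in\mathbb{C}^d$ be a $\delta$-SG configuration. Then $\dim\{v_1,\ldots,v_n\}<13/\delta^2$. Moreover, the dimension of any $1$-SG configuration is at most $10$.
   Context: A point configuration is a finite set of distinct points in $\mathbb{C}^d$; its dimension $\dim\{v_1,\ldots,v_n\}$ is the dimension of the smallest affine subspace containing all the points. A line is special if it passes through at least three of the points. For $\delta\in[0,1]$, the distinct points $v_1,\ldots,v_n\in\mathbb{C}^d$ form a $\delta$-SG configuration if for every $i\in[n]$ there is a family $L_i$ of special lines, all passing through $v_i$, such that at least $\delta n$ of the points $v_1,\ldots,v_n$ lie on lines of $L_i$. *)

(* Defs.v *)
From mathcomp Require Import all_boot all_order all_algebra.
From mathcomp Require Import boolp classical_sets reals.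
From mathcomp.real_closed Require Import complex.

Set Implicit Arguments.
Unset Strict Implicit.
Unset Printing Implicit Defensive.

Import Order.TTheory GRing.Theory Num.Theory.
Local Open Scope ring_scope.

Section AffineSubspaces.
Variables (K : fieldType) (V : vectType K).

(* The nonempty affine subspace [base + direction].  Distinct records may
   denote the same set of points. *)
Record affine_subspace := AffineSubspace { base : V; direction : {vspace V} }.

Definition in_affine (A : affine_subspace) : pred V :=
  fun x => x - base A \in direction A.
Canonical affine_predType := PredType in_affine.

Definition affine_dim (A : affine_subspace) : nat := \dim (direction A).

Variables (n : nat) (v : 'I_n -> V).

Definition passes_all (A : affine_subspace) : Prop := forall i, v i \in A.

Definition smallest_affine (A : affine_subspace) : Prop :=
  passes_all A /\ forall B, passes_all B -> {subset A <= B}.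

(* [smallest_affine] holds of some A as soon as n > 0, and all such A have the
   same dimension (see [config_dimE]); the value is 0 for the empty
   configuration. *)
Definition config_dim : nat :=
  xget 0%N [set k | exists2 A, smallest_affine A & affine_dim A = k]%classic.

Definition is_line (A : affine_subspace) : Prop := affine_dim A = 1%N.

(* At least three indices; these are three points when v is injective. *)
Definition special_line (A : affine_subspace) : Prop :=
  is_line A /\ (3 <= #|[set i | v i \in A]|)%N.

Definition points_on (L : set affine_subspace) : {set 'I_n} :=
  [set i | `[< exists2 l, L l & v i \in l >]].

End AffineSubspaces.

Definition SG_configuration (R : realType) (delta : R) (d n : nat)
    (v : 'I_n -> 'rV[R[i]]_d) : Prop :=
  injective v /\
  forall i : 'I_n, exists L : set (affine_subspace 'rV[R[i]]_d),
    (forall l, L l -> special_line v l /\ v i \in l) /\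
    delta * n%:R <= #|points_on v L|%:R.

Section AffineTheory.
Variables (K : fieldType) (V : vectType K).
Implicit Types A B : affine_subspace V.

Lemma in_affineE A x : (x \in A) = (x - base A \in direction A).
Proof. by []. Qed.

Lemma sub_affine_dim A B : {subset A <= B} -> (affine_dim A <= affine_dim B)%N.
Proof.
move=> sAB; apply/dimvS/subvP => u Au.
have b0 : base A \in A by rewrite in_affineE subrr mem0v.
have b1 : base A + u \in A by rewrite in_affineE addrC addKr.
have := memvB (sAB _ b1) (sAB _ b0).
by rewrite opprB addrA subrK addrC addKr.
Qed.

Variables (n : nat) (v : 'I_n -> V).

Lemma smallest_affine_span (i0 : 'I_n) :
  smallest_affine v (AffineSubspace (v i0) <<[seq v i - v i0 | i : 'I_n]>>%VS).
Proof.
split=> [i|B vB x].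
  by rewrite in_affineE /=; exact: memv_span (codom_f (fun j => v j - v i0) i).
rewrite !in_affineE /= => sx.
have: (<<[seq v i - v i0 | i : 'I_n]>> <= direction B)%VS.
  apply/span_subvP => y /(@codomP _ _ (fun j => v j - v i0))[i ->].
  by have := memvB (vB i) (vB i0); rewrite opprB addrA subrK.
move=> /subvP sub; have h := sub _ sx.
by have := memvD h (vB i0); rewrite addrA subrK.
Qed.

Lemma config_dimE A : smallest_affine v A -> config_dim v = affine_dim A.
Proof.
move=> [vA mA]; apply: xget_unique; first by exists A.
move=> k [B [vB mB] <-]; apply/eqP; rewrite eqn_leq.
by rewrite !sub_affine_dim //; [apply: mA | apply: mB].
Qed.

Lemma config_dim_span (i0 : 'I_n) :
  config_dim v = \dim <<[seq v i - v i0 | i : 'I_n]>>.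
Proof. exact: config_dimE (smallest_affine_span i0). Qed.

End AffineTheory.

(* Main.v *)
(** In homogeneous coordinates the points become n pairwise independent vectors
  spanning a space of dimension D > dim.  Pass to a quotient of that space in
  which the number N of nonzero images per dimension r is minimal, so that
  N / r <= n / D and no subspace of the quotient contains more than its
  proportional share of these images.  By this minimality the potential
  (prod_i |v_i T|^2)^r / |det T|^(2 N) is bounded below over invertible T, while
  rescaling along the eigenvectors of the frame operator of the unit vectors
  u_i = v_i T / |v_i T| divides it by at least 9/8 as long as
  sum_(i, j) |<u_i, u_j>|^2 > 2 N^2 / r (the optimal value is N^2 / r).  Hence
  some T brings this sum below 2 N^2 / r.  On the other hand the points of a
  special line span at most a plane (a line, when one of them is killed by the
  quotient), so their unit vectors have large mutual inner products: if every
  point sees k others on special lines, the sum is at least N + N k / 4.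
  Together D (k + 4) <= 8 n, with k + 1 >= delta n, which gives
  dim <= 8 / delta. *)
Require Import Defs.
From mathcomp Require Import all_boot all_order all_algebra.
From mathcomp Require Import boolp classical_sets reals.
From mathcomp.real_closed Require Import complex.
From mathcomp Require Import perm ring lra zify.

Set Implicit Arguments.
Unset Strict Implicit.
Unset Printing Implicit Defensive.

Import Order.TTheory GRing.Theory Num.Theory.
Local Open Scope ring_scope.
Local Open Scope sesquilinear_scope.

(** Some [x k] exceeds 2, since otherwise [x k ^+ 2 <= 2 * x k] throughout. Averaging every factor
    with 1 keeps the sum at [D], so AM-GM bounds the product of the averages [y j] by 1. Always
    [x j <= y j ^+ 2], and at [k] there is a gain of 8/9, the value of x / ((1 + x) / 2)^2 at x =
    2. *)
Lemma prod_le_of_sum_sqr_gt (F : numFieldType) (D : nat) (x : 'I_D -> F) :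
  (forall k, 0 < x k) -> \sum_k x k = D%:R -> 2 * D%:R < \sum_k x k ^+ 2 ->
  \prod_k x k <= 8 / 9.
Proof.
move=> x0 sx sx2.
have D0 : (0 < D)%N.
  by case: D x x0 sx sx2 => // x _ _; rewrite big_ord0 mulr0 ltxx.
have [k xk2] : exists k, 2 < x k.
  apply/existsP; rewrite -[[exists _, _]]negbK negb_exists; apply/negP => /forallP h.
  have : \sum_k x k ^+ 2 <= \sum_k 2 * x k.
    apply: ler_sum => k _; rewrite expr2 ler_pM2r //.
    by rewrite real_leNgt ?h ?gtr0_real.
  rewrite -mulr_sumr sx => /(lt_le_trans sx2); by rewrite ltxx.
pose y j := (1 + x j) / 2.
have y0 j : 0 < y j by rewrite divr_gt0 // addr_gt0.
have yx j : x j <= y j ^+ 2.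
  rewrite -subr_ge0; have -> : y j ^+ 2 - x j = ((x j - 1) / 2) ^+ 2 by rewrite /y; field.
  by rewrite real_exprn_even_ge0 // rpredM ?rpredB ?rpredV ?gtr0_real.
have yk : x k <= 8 / 9 * y k ^+ 2.
  rewrite -subr_ge0.
  have -> : 8 / 9 * y k ^+ 2 - x k = (2 * x k - 1) * (x k - 2) * (1 / 9).
    by rewrite /y; field.
  apply: mulr_ge0; last by rewrite divr_ge0.
  apply: mulr_ge0; last by rewrite subr_ge0 ltW.
  rewrite subr_ge0 mulr_ege1 ?ler1n //.
  by apply: ltW; apply: lt_trans xk2; rewrite ltr1n.
have yle1 : \prod_j y j <= 1.
  have := (@leif_AGM _ _ predT y (fun i _ => ltW (y0 i))).1.
  have -> : \sum_(i in predT) y i = D%:R.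
    transitivity (\sum_j (1 + x j) / 2); first by apply: eq_bigl.
    rewrite -mulr_suml big_split /= sx sumr_const card_ord.
    by field.
  rewrite cardT size_enum_ord divff ?pnatr_eq0 -?lt0n // expr1n.
  by apply: le_trans; rewrite le_eqVlt; apply/orP; left; apply/eqP; apply: eq_bigl.
rewrite (bigD1 k) //=.
apply: (@le_trans _ _ (8 / 9 * (\prod_j y j) ^+ 2)); last first.
  have y_ge0 : 0 <= \prod_j y j by apply: prodr_ge0 => j _; apply: ltW.
  by rewrite ler_piMr ?exprn_ile1 // divr_ge0.
rewrite -prodrXl [X in _ <= _ * X](bigD1 k) //= mulrA.
apply: ler_pM => //; first exact: ltW.
  by apply: prodr_ge0 => j _; apply: ltW.
by apply: ler_prod => j _; rewrite ltW //=.
Qed.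

(** * Frame potential and the rescaling step *)

Section Frames.
Variable C : numClosedFieldType.
Implicit Types (N D : nat).

Definition rownorm N D (V : 'M[C]_(N, D)) (i : 'I_N) : C := \sum_k `|V i k| ^+ 2.

(** A zero row stays zero, because [x / 0 = 0]; such rows contribute nothing to the frame
    potential. *)
Definition unit_rows N D (V : 'M[C]_(N, D)) : 'M[C]_(N, D) :=
  \matrix_(i, k) (V i k / sqrtC (rownorm V i)).

Definition frame_potential N D (U : 'M[C]_(N, D)) : C :=
  \sum_i \sum_j `|(U *m U^t*) i j| ^+ 2.

Lemma rownorm_ge0 N D (V : 'M[C]_(N, D)) i : 0 <= rownorm V i.
Proof. by apply: sumr_ge0 => k _; rewrite exprn_ge0. Qed.

Lemma rownorm_gt0 N D (V : 'M[C]_(N, D)) i : (0 < rownorm V i) = (row i V != 0).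
Proof.
rewrite lt_def rownorm_ge0 andbT; congr (~~ _).
rewrite psumr_eq0 => [|k _]; last by rewrite exprn_ge0.
apply/allP/eqP => [h|h k _].
  apply/rowP => k; have := h k (mem_index_enum k); rewrite !mxE implyTb.
  by rewrite expf_eq0 /= normr_eq0 => /eqP.
by rewrite implyTb; move/rowP: h => /(_ k); rewrite !mxE => ->; rewrite normr0 expr0n.
Qed.

Lemma rownorm_diag N D (U : 'M[C]_(N, D)) i : (U *m U^t*) i i = rownorm U i.
Proof. by rewrite mxE; apply: eq_bigr => k _; rewrite !mxE normCK. Qed.

Lemma rownorm_unitary N D (U : 'M[C]_(N, D)) (P : 'M[C]_D) i :
  P \is unitarymx -> rownorm (U *m P^t*) i = rownorm U i.
Proof.
move=> uP; rewrite -!rownorm_diag trmx_mul map_mxM -/(_^t*) trmxCK mulmxA.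
by rewrite mulmxKtV.
Qed.

Lemma rownorm_unit_rows N D (V : 'M[C]_(N, D)) i :
  row i V != 0 -> rownorm (unit_rows V) i = 1.
Proof.
rewrite -rownorm_gt0 => V0.
transitivity (\sum_k `|V i k| ^+ 2 / rownorm V i).
  apply: eq_bigr => k _; rewrite !mxE normrM exprMn normfV exprVn.
  by rewrite -[`|sqrtC _| ^+ 2]normrX sqrtCK (gtr0_norm V0).
by rewrite -mulr_suml divff // lt0r_neq0.
Qed.

Lemma unit_rowsM N D (V : 'M[C]_(N, D)) (A : 'M[C]_D) i k :
  row i V != 0 -> (V *m A) i k = sqrtC (rownorm V i) * (unit_rows V *m A) i k.
Proof.
rewrite -rownorm_gt0 => V0; rewrite !mxE mulr_sumr; apply: eq_bigr => j _.
by rewrite !mxE mulrA mulrCA divff ?mulr1 // sqrtC_eq0 lt0r_neq0.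
Qed.

(** By cyclicity of the trace, the Gram matrix and the frame operator have the same trace of
    squares. *)
Lemma frame_potentialE N D (U : 'M[C]_(N, D)) :
  frame_potential U = \tr ((U^t* *m U) *m (U^t* *m U)).
Proof.
rewrite mulmxA mxtrace_mulC !mulmxA -mulmxA.
apply: eq_bigr => i _; rewrite mxE; apply: eq_bigr => j _.
rewrite normCK; congr (_ * _); rewrite !mxE rmorph_sum; apply: eq_bigr => k _.
by rewrite !mxE rmorphM /= conjCK mulrC.
Qed.

(** Zero rows are orthogonal to everything. This links the full index set, on which lines are
    defined, to the surviving rows, on which the rescaling acts. *)
Lemma frame_potential_live N d (U : 'M[C]_(N, d)) (A : {set 'I_N}) :
  (forall i, i \notin A -> row i U = 0) ->
  frame_potential (rowsub (fun k : 'I_#|A| => enum_val k) U) = frame_potential U.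
Proof.
move=> UA.
have gE i j : `|(U *m U^t*) i j| ^+ 2 =
    if (i \in A) && (j \in A) then `|(U *m U^t*) i j| ^+ 2 else 0.
  case: ifP => // /negbT/nandP nij; rewrite mxE big1 ?normr0 ?expr0n // => k _.
  rewrite !mxE; case: nij => /UA/rowP/(_ k); rewrite !mxE => ->; first by rewrite mul0r.
  by rewrite rmorph0 mulr0.
rewrite /frame_potential; under [RHS]eq_bigr => i _.
  under eq_bigr => j _ do rewrite gE.
  over.
transitivity (\sum_(i in A) \sum_(j in A) `|(U *m U^t*) i j| ^+ 2).
  rewrite [RHS]big_enum_val; apply: eq_bigr => i _.
  rewrite [RHS]big_enum_val; apply: eq_bigr => j _.
  congr (`|_| ^+ 2); rewrite !mxE; apply: eq_bigr => k _; by rewrite !mxE.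
rewrite [LHS]big_mkcond; apply: eq_bigr => i _; case: ifP => iA; last by rewrite big1.
by rewrite big_mkcond.
Qed.

Lemma frame_spectral N D (U : 'M[C]_(N, D)) :
  exists2 P : 'M[C]_D, P \is unitarymx &
  exists l : 'rV[C]_D, (U *m P^t*)^t* *m (U *m P^t*) = diag_mx l.
Proof.
set S := U^t* *m U.
have nS : S \is normalmx.
  by apply/normalmxP; rewrite /S trmx_mul map_mxM -/(_^t*) trmxCK.
have uP := spectral_unitarymx S; exists (spectralmx S) => //.
exists (spectral_diag S).
rewrite trmx_mul map_mxM -/(_^t*) trmxCK mulmxA -(mulmxA _ _ U) -/S.
rewrite {2}(orthomx_spectralP nS) invmx_unitary //.
rewrite !mulmxA (unitarymxP uP) mul1mx -mulmxA (unitarymxP uP) mulmx1 //.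
Qed.

Lemma normr_det_unitary D (Q : 'M[C]_D) : Q \is unitarymx -> `|\det Q| ^+ 2 = 1.
Proof.
move=> /unitarymxP /(congr1 determinant).
by rewrite det_mulmx det1 det_map_mx det_tr /= -normCK.
Qed.

(* In an orthonormal basis diagonalising the frame operator of the normalised
   rows, divide the k-th coordinate by the square root of the k-th eigenvalue. *)
Lemma rescaling_step N D (V : 'M[C]_(N, D)) :
  (0 < N)%N -> (0 < D)%N -> row_full V -> (forall i, row i V != 0) ->
  2 * N%:R ^+ 2 / D%:R < frame_potential (unit_rows V) ->
  exists2 T : 'M[C]_D, T \in unitmx &
    (\prod_i rownorm (V *m T) i) ^+ D <=
    8 / 9 * (`|\det T| ^+ (2 * N) * (\prod_i rownorm V i) ^+ D).
Proof.
move=> N0 D0 fV V0 hV; set U := unit_rows V in hV.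
have [P uP [l dl]] := frame_spectral U.
set Q := P^t* in dl.
have uQ : Q \is unitarymx by rewrite trmxC_unitary.
have lE k : l 0 k = \sum_i `|(U *m Q) i k| ^+ 2.
  move/matrixP/(_ k k): dl; rewrite [RHS]mxE eqxx mulr1n => <-.
  by rewrite mxE; apply: eq_bigr => i _; rewrite !mxE mulrC normCK.
(* A zero eigenvalue would annihilate column [k] of [V *m Q], against full column rank. *)
have l0 k : 0 < l 0 k.
  rewrite lt_def lE sumr_ge0 ?andbT => [|i _]; last by rewrite exprn_ge0.
  apply/negP; rewrite psumr_eq0 => [/allP h|i _]; last by rewrite exprn_ge0.
  have /row_fullP[B /matrixP/(_ k k)] : row_full (V *m Q).
    by rewrite /row_full mxrankMfree // row_free_unit unitarymx_unit.
  rewrite !mxE eqxx mulr1n big1 => [/eqP|i _]; first by rewrite eq_sym oner_eq0.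
  have := h i (mem_index_enum i); rewrite implyTb expf_eq0 /= normr_eq0 => /eqP UQ0.
  by rewrite unit_rowsM // UQ0 !mulr0.
have N0' : N%:R != 0 :> C by rewrite pnatr_eq0 -lt0n.
have D0' : D%:R != 0 :> C by rewrite pnatr_eq0 -lt0n.
have trl : \sum_k l 0 k = N%:R.
  rewrite -mxtrace_diag -dl mxtrace_mulC /mxtrace.
  under eq_bigr => i _ do rewrite rownorm_diag rownorm_unitary // rownorm_unit_rows //.
  by rewrite sumr_const card_ord.
have trl2 : \sum_k l 0 k ^+ 2 = frame_potential U.
  have -> : frame_potential U = frame_potential (U *m Q).
    by rewrite /frame_potential trmx_mul map_mxM -/(_^t*) trmxCK mulmxA mulmxKtV.
  rewrite frame_potentialE dl mulmx_diag mxtrace_diag.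
  by apply: eq_bigr => k _; rewrite mxE.
(* The normalised eigenvalues have mean 1, and [hV] says that their squares have mean above 2. *)
have le89 : \prod_k (l 0 k * (D%:R / N%:R)) <= 8 / 9.
  apply: prod_le_of_sum_sqr_gt => [k||].
  - by rewrite mulr_gt0 // divr_gt0 ?ltr0n.
  - by rewrite -mulr_suml trl mulrC divfK.
  have -> : \sum_k (l 0 k * (D%:R / N%:R)) ^+ 2 = frame_potential U * (D%:R / N%:R) ^+ 2.
    by rewrite -trl2 mulr_suml; apply: eq_bigr => k _; rewrite exprMn.
  rewrite -ltr_pdivrMr ?exprn_gt0 ?divr_gt0 ?ltr0n //.
  apply: le_lt_trans hV; rewrite le_eqVlt; apply/orP; left; apply/eqP.
  by field; rewrite N0' D0'.
pose m : 'rV[C]_D := \row_k (sqrtC (l 0 k))^-1.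
have m2 k : `|m 0 k| ^+ 2 = (l 0 k)^-1.
  by rewrite mxE normfV exprVn -normrX sqrtCK gtr0_norm.
have detm : `|\det (diag_mx m)| ^+ 2 = (\prod_k l 0 k)^-1.
  rewrite det_diag normr_prod -prodrXl -prodfV; exact: eq_bigr.
have pl0 : 0 < \prod_k l 0 k by apply: prodr_gt0 => k _.
exists (Q *m diag_mx m).
  rewrite unitmx_mul unitarymx_unit //= unitmxE unitfE; apply/eqP => d0.
  move/esym/eqP: detm; rewrite d0 normr0 expr0n /= invr_eq0.
  by rewrite (negPf (lt0r_neq0 pl0)).
have detT : `|\det (Q *m diag_mx m)| ^+ (2 * N) = (\prod_k l 0 k) ^- N.
  rewrite exprM -exprVn; congr (_ ^+ N); rewrite det_mulmx normrM exprMn detm.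
  by rewrite normr_det_unitary // mul1r.
have rnE i : rownorm (V *m (Q *m diag_mx m)) i =
    rownorm V i * \sum_k `|(U *m Q) i k| ^+ 2 / l 0 k.
  rewrite mulr_sumr; apply: eq_bigr => k _.
  rewrite mulmxA mul_mx_diag mxE normrM exprMn m2 unit_rowsM // normrM exprMn.
  by rewrite -[`|sqrtC _| ^+ 2]normrX sqrtCK (ger0_norm (rownorm_ge0 _ _)) -mulrA.
rewrite (eq_bigr _ (fun i _ => rnE i)) big_split /= exprMn detT.
rewrite [X in _ <= X]mulrA [X in _ <= X]mulrC; apply: ler_wpM2l.
  by apply: exprn_ge0; apply: prodr_ge0 => i _; apply: rownorm_ge0.
(* [E i] is the factor by which the squared norm of row [i] changes. These factors sum to [D], so
   AM-GM bounds their product by [(D / N) ^ N]. *)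
set E := fun i => \sum_k `|(U *m Q) i k| ^+ 2 / l 0 k.
have E0 i : 0 <= E i.
  by apply: sumr_ge0 => k _; rewrite divr_ge0 ?exprn_ge0 // ltW.
have sE : \sum_i E i = D%:R.
  rewrite exchange_big /= (eq_bigr (fun=> 1)) ?sumr_const ?card_ord // => k _.
  by rewrite -mulr_suml -lE divff // lt0r_neq0.
have pE : \prod_i E i <= (D%:R / N%:R) ^+ N.
  have := (@leif_AGM _ _ predT E (fun i _ => E0 i)).1.
  rewrite cardT size_enum_ord.
  have -> : \sum_(i in predT) E i = D%:R by rewrite -sE; apply: eq_bigl.
  by apply: le_trans; rewrite le_eqVlt; apply/orP; left; apply/eqP; apply: eq_bigl.
have q0 : 0 < D%:R / N%:R :> C by rewrite divr_gt0 ?ltr0n.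
apply: (@le_trans _ _ ((D%:R / N%:R) ^+ N ^+ D)).
  apply: lerXn2r => //; rewrite nnegrE; first by apply: prodr_ge0 => i _; apply: E0.
  by rewrite exprn_ge0 // ltW.
rewrite -exprVn -ler_pdivrMr ?exprn_gt0 ?invr_gt0 // -exprVn invrK -!exprM.
rewrite [(N * D)%N]mulnC exprM -exprMn mulrC.
have -> : \prod_k l 0 k * (D%:R / N%:R) ^+ D = \prod_k (l 0 k * (D%:R / N%:R)).
  by rewrite big_split /= prodr_const card_ord.
set p := \prod_k _ in le89 *.
have p0 : 0 <= p by apply: prodr_ge0 => k _; rewrite mulr_ge0 ?ltW.
(* What is left is [p ^+ N <= 8 / 9], which follows from [p <= 8 / 9 < 1] and [N > 0]. *)
apply: le_trans (le89); rewrite -[leRHS]expr1; apply: ler_wiXn2l => //.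
by apply: le_trans le89 _; rewrite ler_pdivrMr // mul1r ler_nat.
Qed.

End Frames.

(** Cauchy-Schwarz against the constant vector: the two sides differ by the sum of
    [(y k - y l) ^+ 2 / 2] over all [k] and [l]. *)
Lemma sqr_sum_le (F : numFieldType) (r : nat) (y : 'I_r -> F) :
  (forall k, y k \is Num.real) -> (\sum_k y k) ^+ 2 <= r%:R * \sum_k y k ^+ 2.
Proof.
move=> ry.
have -> : r%:R * \sum_k y k ^+ 2 = \sum_k \sum_l (y k ^+ 2 + y l ^+ 2) / 2.
  under [RHS]eq_bigr => k _ do rewrite -mulr_suml big_split /= sumr_const card_ord.
  rewrite -mulr_suml big_split /= sumr_const card_ord sumrMnl -[_ *+ r]mulr_natl.
  by field.
rewrite expr2 mulr_suml; apply: ler_sum => k _; rewrite mulr_sumr.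
apply: ler_sum => l _; rewrite -subr_ge0.
have -> : (y k ^+ 2 + y l ^+ 2) / 2 - y k * y l = (y k - y l) ^+ 2 / 2 by field.
by rewrite divr_ge0 // real_exprn_even_ge0 // rpredB.
Qed.

(** * The Welch bound for row families of small rank *)

Section Welch.
Variable C : numClosedFieldType.

(** In an orthonormal basis of the row space the frame operator has size [\rank U], and its trace is
    the sum of the squared row norms. Cauchy-Schwarz on its diagonal gives the bound once the
    off-diagonal entries are dropped. *)
Lemma sqr_sum_rownorm_le N D (s : nat) (U : 'M[C]_(N, D)) :
  (\rank U <= s)%N -> (\sum_i rownorm U i) ^+ 2 <= s%:R * frame_potential U.
Proof.
move=> rs.
have FP0 n m (W : 'M[C]_(n, m)) : 0 <= frame_potential W.
  by do 2![apply: sumr_ge0 => ? _]; rewrite exprn_ge0.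
apply: (@le_trans _ _ ((\rank U)%:R * frame_potential U)); last first.
  by apply: ler_wpM2r => //; rewrite ler_nat.
set E := schmidt (row_base U).
have uE : E \is unitarymx by apply: schmidt_unitarymx; apply: rank_leq_col.
have [A UE] : exists A, U = A *m E.
  by apply/submxP; apply: submx_trans (schmidt_sub _); rewrite eq_row_base.
have UA : U *m U^t* = A *m A^t*.
  have UF r (B : 'M_(N, r)) (F : 'M_(r, D)) :
      F \is unitarymx -> U = B *m F -> U *m U^t* = B *m B^t*.
    by move=> uF ->; rewrite trmx_mul map_mxM -/(_^t*) mulmxA mulmxtVK.
  exact: UF uE UE.
have -> : frame_potential U = frame_potential (A^t*).
  rewrite [LHS]frame_potentialE [RHS]frame_potentialE trmxCK -UA.
  by rewrite [in LHS]mulmxA [LHS]mxtrace_mulC !mulmxA.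
have -> : \sum_i rownorm U i = \sum_k rownorm (A^t*) k.
  under eq_bigr => i _ do rewrite -rownorm_diag UA rownorm_diag.
  rewrite /rownorm exchange_big /=; apply: eq_bigr => k _; apply: eq_bigr => i _.
  by rewrite !mxE norm_conjC.
apply: (le_trans (sqr_sum_le _)) => [k|]; first by rewrite ger0_real ?rownorm_ge0.
apply: ler_wpM2l; first by rewrite ler0n.
apply: ler_sum => k _; rewrite (bigD1 k) //= rownorm_diag ger0_norm ?rownorm_ge0 //.
by rewrite lerDl; apply: sumr_ge0 => l _; rewrite exprn_ge0.
Qed.

End Welch.

(** * A lower bound for the potential, uniform in the transformation *)

Section LowerBound.
Variable C : numClosedFieldType.

(** Each of the D! terms of the Leibniz formula is at most the product of the row norms. This weak
    form of Hadamard's inequality suffices where the constant only has to be positive. *)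
Lemma sqr_det_le D (A : 'M[C]_D) :
  `|\det A| ^+ 2 <= (D`!)%:R ^+ 2 * \prod_i rownorm A i.
Proof.
have sq i : sqrtC (rownorm A i) ^+ 2 = rownorm A i by rewrite sqrtCK.
under eq_bigr => i _ do rewrite -sq.
rewrite prodrXl -exprMn; apply: lerXn2r; rewrite ?nnegrE ?normr_ge0 //.
  rewrite mulr_ge0 ?ler0n // prodr_ge0 // => i _.
  by rewrite sqrtC_ge0 rownorm_ge0.
apply: (le_trans (ler_norm_sum _ _ _)).
rewrite -(card_Sn D) mulr_natl -sumr_const [leRHS]big_mkcond /=.
apply: ler_sum => s _; rewrite ?inE /=.
rewrite normrM normrX normrN1 expr1n mul1r normr_prod.
apply: ler_prod => i _; rewrite normr_ge0 /=.
rewrite -[leLHS]sqrCK // ler_sqrtC ?nnegrE ?rownorm_ge0 ?exprn_ge0 //.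
rewrite /rownorm (bigD1 (s i)) //= lerDl; apply: sumr_ge0 => j _.
by rewrite exprn_ge0.
Qed.

Definition row_span N D (V : 'M[C]_(N, D)) (s : seq 'I_N) : 'M[C]_D :=
  (\sum_(i <- s) <<row i V>>)%MS.

Lemma row_span_sub N D m (V : 'M[C]_(N, D)) (s : seq 'I_N) (M : 'M[C]_(m, D)) :
  (forall i, i \in s -> (row i V <= M)%MS) -> (row_span V s <= M)%MS.
Proof.
rewrite /row_span; elim: s => [|i s IH] sM; first by rewrite big_nil sub0mx.
rewrite big_cons addsmx_sub genmxE sM ?mem_head //=.
by apply: IH => j js; apply: sM; rewrite inE js orbT.
Qed.

(** Induction on [s] from the right: a row joins the basis when it leaves the span of the earlier
    rows. The exponent of [z] is the slack in the density hypothesis. The inductive call takes for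
    [z] the weight of the new row, the largest so far by sortedness. *)
Lemma greedy_basis N D (V : 'M[C]_(N, D)) (w : 'I_N -> C) (s : seq 'I_N) (z : C) :
  (forall i, 0 < w i) -> 0 < z -> (forall i, i \in s -> w i <= z) ->
  pairwise (fun i j => w i <= w j) s ->
  (forall s1 s2, s = s1 ++ s2 -> size s1 * D <= N * \rank (row_span V s1))%N ->
  exists B : seq 'I_N, [/\ (row_span V B :=: row_span V s)%MS,
    size B = \rank (row_span V s) &
    (\prod_(i <- B) w i) ^+ N <=
    (\prod_(i <- s) w i) ^+ D * z ^+ (N * \rank (row_span V s) - size s * D)].
Proof.
move=> w0; elim/last_ind: s z => [|s x IH] z z0 sz ps dens.
  exists [::]; split => //; first by rewrite /row_span big_nil mxrank0.
  by rewrite !big_nil !expr1n mul1r /row_span big_nil mxrank0 muln0 sub0n expr0.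
move: ps; rewrite pairwise_rcons => /andP[/allP lex ps].
have densS s1 s2 : s = s1 ++ s2 -> (size s1 * D <= N * \rank (row_span V s1))%N.
  by move=> es; apply: (dens s1 (rcons s2 x)); rewrite es rcons_cat.
have := dens (rcons s x) [::]; rewrite cats0 => /(_ erefl); rewrite size_rcons => densx.
have [B [eB sB hB]] := IH (w x) (w0 x) lex ps densS.
have spE : row_span V (rcons s x) = (row_span V s + <<row x V>>)%MS.
  by rewrite /row_span big_rcons.
have zx : w x <= z by apply: sz; rewrite mem_rcons inE eqxx.
set r := \rank (row_span V s) in sB hB.
set e := (N * r - size s * D)%N in hB.
have pw0 : 0 <= (\prod_(i <- s) w i) ^+ D.
  by rewrite exprn_ge0 // prodr_ge0 // => i _; apply: ltW.
have [xs|xs] := boolP (row x V <= row_span V s)%MS.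
- have eqs : (row_span V (rcons s x) :=: row_span V s)%MS.
    by rewrite spE; apply: addsmx_idPl; rewrite genmxE.
  exists B; split; first exact: eqmx_trans eB (eqmx_sym eqs).
    by rewrite eqs.
  have rE : \rank (row_span V (rcons s x)) = r by rewrite eqs.
  rewrite {}rE in densx *.
  apply: (le_trans hB); rewrite big_rcons /= exprMn -mulrA.
  apply: ler_wpM2l => //.
  (* A dependent row spends [D] of the available powers of [w x] on its own factor in the product
     over [s]; the others grow to powers of [z]. *)
  have -> : e = (D + (N * r - (size s).+1 * D))%N.
    by rewrite /e; move: densx; rewrite mulSn; lia.
  rewrite exprD; apply: ler_wpM2l; first by rewrite exprn_ge0 // ltW.
  by apply: lerXn2r => //; rewrite nnegrE ltW.
have rS : \rank (row_span V (rcons s x)) = r.+1.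
  rewrite spE; apply/eqP; rewrite eqn_leq; apply/andP; split.
    have := (mxrank_adds_leqif (row_span V s) <<row x V>>%MS).1; rewrite -/r.
    move/leq_trans; apply; rewrite -(addn1 r) leq_add2l mxrank_gen.
    exact: rank_leq_row.
  rewrite /r ltnNge; apply: contraNN xs => h.
  have := mxrank_leqif_sup (addsmxSl (row_span V s) <<row x V>>%MS).
  move=> [le /esym]; rewrite eqn_leq le h => hs.
  by have := submx_trans (addsmxSr _ _) hs; rewrite genmxE.
exists (rcons B x); split; first last.
- rewrite rS !big_rcons /= !exprMn.
  apply: (le_trans (ler_wpM2r _ hB)); first by rewrite exprn_ge0 // ltW.
  rewrite -!mulrA; apply: ler_wpM2l => //.
  rewrite rS in densx.
  (* An independent row adds [N] powers of [w x] from the basis side; again [D] are spent and the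
     others grow. *)
  have ee : (e + N = D + (N * r.+1 - (size s).+1 * D))%N.
    have := densS s [::]; rewrite cats0 -/r /e => /(_ erefl); move: densx.
    by rewrite mulSn mulnS; lia.
  rewrite -exprD ee exprD; apply: ler_wpM2l; first by rewrite exprn_ge0 // ltW.
  by apply: lerXn2r => //; rewrite nnegrE ltW.
- by rewrite size_rcons sB rS.
- rewrite spE /row_span big_rcons /=; apply: adds_eqmx => //.
Qed.

(* The last hypothesis says that no subspace contains more than its proportional
   share of the rows; Abel summation along a greedy basis, which takes the rows
   by increasing norm, uses it to compare norms. *)
Lemma potential_bounded_below N D (V : 'M[C]_(N, D)) :
  (0 < N)%N -> row_full V -> (forall i, row i V != 0) ->
  (forall s : seq 'I_N, uniq s -> size s * D <= N * \rank (row_span V s))%N ->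
  exists2 g : C, 0 < g & forall T : 'M[C]_D, T \in unitmx ->
    g * `|\det T| ^+ (2 * N) <= (\prod_i rownorm (V *m T) i) ^+ D.
Proof.
move=> N0 fV V0 dens; pose i0 := Ordinal N0.
pose h (f : {ffun 'I_D -> 'I_N}) : C :=
  (`|\det (rowsub f V)| ^+ 2 / D`!%:R ^+ 2) ^+ N.
have F0 : 0 < D`!%:R ^+ 2 :> C by rewrite exprn_gt0 // ltr0n fact_gt0.
have h0 f : 0 <= h f by rewrite exprn_ge0 // divr_ge0 ?exprn_ge0.
(* The greedy basis depends on [T], so the constant must serve all choices [f] at once: [S^-1] lies
   below every nonzero [h f], and a vanishing [h f] adds [0^-1 = 0] to the sum. *)
pose S := 1 + \sum_f (h f)^-1.
have S0 : 0 < S by rewrite ltr_wpDr // sumr_ge0 // => f _; rewrite invr_ge0.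
exists S^-1; first by rewrite invr_gt0.
move=> T uT; set w := rownorm (V *m T).
have w0 i : 0 < w i.
  rewrite rownorm_gt0 row_mul; apply: contraNneq (V0 i) => e.
  by rewrite -(mulmxK uT (row i V)) e mul0mx.
have wtot : {in predT &, total (fun i j => w i <= w j)}.
  by move=> i j _ _; apply: ger_leVge; apply: ltW.
pose s := sort (fun i j => w i <= w j) (enum 'I_N).
have us : uniq s by rewrite sort_uniq enum_uniq.
have ps : pairwise (fun i j => w i <= w j) s.
  rewrite -sorted_pairwise; last by move=> a b c; apply: le_trans.
  by apply: (sort_sorted_in wtot); apply/allP.
have ms i : i \in s by rewrite mem_sort mem_enum.
(* Any positive upper bound of the weights would do: for the full list its exponent is
   [N * D - N * D = 0]. *)
have z0 : 0 < \sum_i w i + 1.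
  by rewrite ltr_wpDl // sumr_ge0 // => i _; apply: ltW.
have [B [eB sB hB]] : exists B : seq 'I_N, [/\ (row_span V B :=: row_span V s)%MS,
    size B = \rank (row_span V s) &
    (\prod_(i <- B) w i) ^+ N <=
    (\prod_(i <- s) w i) ^+ D * (\sum_i w i + 1) ^+ (N * \rank (row_span V s) - size s * D)].
  apply: greedy_basis => // [i _|s1 s2 es].
    rewrite (bigD1 i) //= -addrA lerDl addr_ge0 // sumr_ge0 // => j _.
    exact: ltW.
  by apply: dens; move: us; rewrite es cat_uniq => /andP[].
have fs : (V <= row_span V s)%MS.
  apply/row_subP => i; rewrite /row_span (big_rem i) //=.
  by apply: submx_trans (addsmxSl _ _); rewrite genmxE.
have rs : \rank (row_span V s) = D.
  apply/eqP; rewrite eqn_leq rank_leq_row /=.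
  by have := mxrankS fs; rewrite (eqP fV).
have ss : size s = N by rewrite size_sort size_enum_ord.
rewrite rs ss mulnC subnn expr0 mulr1 in hB sB.
have sE : \prod_(i <- s) w i = \prod_i w i.
  by rewrite (perm_big (enum 'I_N)) ?perm_sort //= big_enum.
rewrite {}sE in hB.
pose f : {ffun 'I_D -> 'I_N} := [ffun k : 'I_D => nth i0 B k].
have BE : \prod_(i <- B) w i = \prod_k w (f k).
  rewrite (big_nth i0) sB big_mkord; apply: eq_bigr => k _; by rewrite ffunE.
have uf : rowsub f V \in unitmx.
  rewrite -row_full_unit -sub1mx -[X in (X <= _)%MS]/(1%:M).
  apply: submx_trans (_ : (row_span V s <= _)%MS).
    by rewrite sub1mx /row_full rs.
  rewrite -eB; apply: row_span_sub => i iB.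
  have iD : (index i B < D)%N by rewrite -sB index_mem.
  apply: eq_row_sub (Ordinal iD) _.
  by apply/rowP => j; rewrite !mxE ffunE nth_index.
have hf : h f != 0.
  rewrite expf_eq0 negb_and mulf_eq0 negb_or invr_eq0 (lt0r_neq0 F0) andbT.
  by rewrite expf_eq0 /= normr_eq0 -unitfE -unitmxE uf orbT.
apply: (@le_trans _ _ (h f * `|\det T| ^+ (2 * N))).
  apply: ler_wpM2r; first by rewrite exprn_ge0.
  rewrite invf_ple ?posrE // ?lt_def ?hf ?h0 //.
  rewrite /S (bigD1 f) //= addrCA lerDl addr_ge0 // sumr_ge0 // => j _.
  by rewrite invr_ge0.
apply: le_trans hB; rewrite exprM -exprMn; apply: lerXn2r.
- by rewrite nnegrE mulr_ge0 ?divr_ge0 ?exprn_ge0 // ltW.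
- by rewrite nnegrE prodr_ge0 // => i _; apply: ltW.
rewrite mulrAC ler_pdivrMr // -exprMn -normrM -det_mulmx mulrC.
have -> : rowsub f V *m T = rowsub f (V *m T) by rewrite mul_rowsub_mx.
apply: (le_trans (sqr_det_le _)); apply: ler_wpM2l; first exact: ltW.
rewrite BE le_eqVlt; apply/orP; left; apply/eqP; apply: eq_bigr => k _.
by apply: eq_bigr => j _; rewrite mxE.
Qed.

End LowerBound.

(** * Existence of a nearly isotropic position *)

Lemma complex_not_ge_nat (R : realType) (x : R[i]) :
  ~ (forall m : nat, m%:R <= x).
Proof.
move=> h; pose m := Num.bound `|complex.Re x|.
have := h m; rewrite lecE => /andP[_].
have -> : complex.Re (m%:R : R[i]) = m%:R.
  by elim: (m) => // k IH; rewrite -!natr1 raddfD /= IH.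
move=> /(le_trans _) le; have := archi_boundP (normr_ge0 (complex.Re x)).
by rewrite -/m ltNge (le_trans (le _ (lexx _)) (ler_norm _)).
Qed.

Lemma bernoulli_le (F : numDomainType) (x : F) (m : nat) :
  0 <= x -> 1 + m%:R * x <= (1 + x) ^+ m.
Proof.
move=> x0; elim: m => [|m IH]; first by rewrite mul0r addr0 expr0.
rewrite exprS; apply: (@le_trans _ _ ((1 + x) * (1 + m%:R * x))).
  rewrite -natr1 -subr_ge0.
  have -> : (1 + x) * (1 + m%:R * x) - (1 + (m%:R + 1) * x) = m%:R * x ^+ 2 by ring.
  by rewrite mulr_ge0 ?exprn_ge0.
by apply: ler_wpM2l => //; rewrite addr_ge0.
Qed.

(** If every [T] had a large frame potential, the rescaling could be iterated forever, and
    [g <= (8 / 9) ^+ m * c] would hold for all [m]. Bernoulli's inequality for [9 / 8 = 1 + 8^-1]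
    turns this into [m <= 8 * (c / g)], against the archimedean property. *)
Lemma near_isotropic (R : realType) N D (V : 'M[R[i]]_(N, D)) :
  (0 < N)%N -> (0 < D)%N -> row_full V -> (forall i, row i V != 0) ->
  (forall s : seq 'I_N, uniq s -> size s * D <= N * \rank (row_span V s))%N ->
  exists2 T : 'M[R[i]]_D, T \in unitmx &
    frame_potential (unit_rows (V *m T)) <= 2 * N%:R ^+ 2 / D%:R.
Proof.
move=> N0 D0 fV V0 dens.
have [g g0 hg] := potential_bounded_below N0 fV V0 dens.
apply: contrapT => hn.
have big (T : 'M[R[i]]_D) : T \in unitmx ->
    2 * N%:R ^+ 2 / D%:R < frame_potential (unit_rows (V *m T)).
  move=> uT; rewrite real_ltNge; last 2 first.
  - by rewrite ger0_real // divr_ge0 // mulr_ge0 // exprn_ge0.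
  - by rewrite ger0_real // ; do 2![apply: sumr_ge0 => ? _]; rewrite exprn_ge0.
  by apply/negP => h; apply: hn; exists T.
pose c := (\prod_i rownorm V i) ^+ D.
have step m : exists2 T : 'M[R[i]]_D, T \in unitmx &
    (\prod_i rownorm (V *m T) i) ^+ D <= (8 / 9) ^+ m * (`|\det T| ^+ (2 * N) * c).
  elim: m => [|m [T uT hT]].
    exists 1%:M; first exact: unitmx1.
    by rewrite mulmx1 det1 normr1 expr1n !mul1r.
  have fVT : row_full (V *m T) by rewrite /row_full mxrankMfree // row_free_unit.
  have VT0 i : row i (V *m T) != 0.
    rewrite row_mul; apply: contraNneq (V0 i) => e.
    by rewrite -(mulmxK uT (row i V)) e mul0mx.
  have [T' uT' hT'] := rescaling_step N0 D0 fVT VT0 (big T uT).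
  exists (T *m T'); first by rewrite unitmx_mul uT.
  rewrite mulmxA; apply: (le_trans hT').
  rewrite [(8 / 9) ^+ m.+1]exprS -[_ * _ ^+ m * _]mulrA.
  apply: ler_wpM2l; first by rewrite divr_ge0.
  rewrite det_mulmx normrM [(_ * `|\det T'|) ^+ _]exprMn [_ * `|\det T'| ^+ _]mulrC.
  rewrite -[_ * _ * c]mulrA [leRHS]mulrCA.
  by apply: ler_wpM2l => //; rewrite exprn_ge0.
apply: (@complex_not_ge_nat R (8 * (c / g))) => m.
have [T uT hT] := step m.
have T0 : 0 < `|\det T| ^+ (2 * N).
  by rewrite exprn_gt0 // normr_gt0 -unitfE -unitmxE.
have h1 : g <= (8 / 9) ^+ m * c.
  by rewrite -(ler_pM2r T0) -mulrA (mulrC c); apply: le_trans (hg T uT) hT.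
have h2 : 1 + m%:R * 8^-1 <= (1 + 8^-1) ^+ m :> R[i] by apply: bernoulli_le; rewrite invr_ge0.
have h3 : g * (1 + 8^-1) ^+ m <= c.
  have e : (8 / 9) ^+ m * (1 + 8^-1) ^+ m = 1 :> R[i].
    by rewrite -exprMn (_ : _ * _ = 1) ?expr1n //; field.
  rewrite (_ : c = (8 / 9) ^+ m * c * (1 + 8^-1) ^+ m); last by rewrite mulrAC e mul1r.
  by apply: ler_wpM2r h1; rewrite exprn_ge0 // addr_ge0 // invr_ge0 ler0n.
rewrite [leRHS]mulrC -ler_pdivrMr // ler_pdivlMr // mulrC.
apply: le_trans h3; apply: ler_wpM2l; first exact: ltW.
by apply: le_trans h2; rewrite lerDr.
Qed.

(** * Lines of points as planes of vectors *)

Section Lines.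
Variables (F : fieldType) (n D : nat) (X : 'M[F]_(n, D)).

Definition line_through (i j : 'I_n) : {set 'I_n} :=
  [set k | (row k X <= row i X + row j X)%MS].

Definition special_pair (i j : 'I_n) : bool :=
  (i != j) && (3 <= #|line_through i j|)%N.

Definition pairwise_independent : Prop :=
  forall i j, i != j -> \rank (row i X + row j X)%MS = 2%N.

Hypothesis indX : pairwise_independent.

Lemma line_throughl i j : i \in line_through i j.
Proof. by rewrite inE addsmxSl. Qed.

Lemma line_throughr i j : j \in line_through i j.
Proof. by rewrite inE addsmxSr. Qed.

(** One span contains the other and both have rank 2. *)
Lemma line_through_eq i j a b : i != j -> a != b ->
  a \in line_through i j -> b \in line_through i j ->
  line_through a b = line_through i j.
Proof.
move=> ij ab; rewrite !inE => ha hb.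
have sab : (row a X + row b X <= row i X + row j X)%MS by rewrite addsmx_sub ha.
have e : (row a X + row b X :=: row i X + row j X)%MS.
  apply/eqmxP; rewrite sab /=.
  by have [_ <-] := mxrank_leqif_sup sab; rewrite !indX.
by apply/setP => k; rewrite !inE e.
Qed.

(** Special pairs are classified by their line, and the class of a line is the set of all ordered
    pairs of distinct points on it; energy can thus be estimated line by line. *)
Lemma sum_special_pair (M : nmodType) (G : 'I_n * 'I_n -> M) (S : {set 'I_n}) i j :
  special_pair i j -> line_through i j = S ->
  \sum_(p | special_pair p.1 p.2 && (line_through p.1 p.2 == S)) G p =
  \sum_(a in S) \sum_(b in S | b != a) G (a, b).
Proof.
move=> /andP[ij S3] eS; rewrite pair_big_dep /=; apply: eq_big => [[a b]|[a b] _] //=.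
apply/andP/and3P => [[/andP[ab _] /eqP eab]|[aS bS ba]].
  by rewrite -eab line_throughl line_throughr eq_sym.
have eab : line_through a b = S.
  by rewrite -eS; apply: line_through_eq; rewrite ?eS // eq_sym.
by rewrite eab eqxx /special_pair eq_sym ba eab -eS.
Qed.

End Lines.

(** * Energy of a single special line *)

Section LineEnergy.
Variables (C : numClosedFieldType) (n D D' : nat).
Variables (X : 'M[C]_(n, D)) (A : 'M[C]_(D, D')).
Hypothesis indX : pairwise_independent X.
Let Y := X *m A.
Let U := unit_rows Y.
Let g i j : C := `|(U *m U^t*) i j| ^+ 2.
Let live i : bool := row i Y != 0.

Let g_ge0 i j : 0 <= g i j. Proof. exact: exprn_ge0. Qed.

Let rownormU i : rownorm U i = (live i)%:R.
Proof.
rewrite /live; case: eqP => [Y0|/eqP Y0]; last exact: rownorm_unit_rows.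
rewrite /rownorm big1 // => k _; have /rowP/(_ k) := Y0; rewrite !mxE => ->.
by rewrite mul0r normr0 expr0n.
Qed.

Let g_diag i : g i i = (live i)%:R.
Proof.
rewrite /g rownorm_diag rownormU; case: live.
  by rewrite normr1 expr1n.
by rewrite normr0 expr0n.
Qed.

(** Let [q] of the [r >= 3] points survive, so the left side is [q * r.-1]. If [q = r], the rank is
    at most 2 and Welch gives [q ^ 2 <= 2 * (q + E)], enough since [q >= 3]. If one point dies, the
    rank is at most 1 and [q ^ 2 <= q + E] with [q = r.-1 >= 2]. If two die, all do. *)
Lemma line_energy i j : special_pair X i j ->
  \sum_(a in line_through X i j) \sum_(b in line_through X i j | b != a) (live a)%:R
  <= 4 * \sum_(a in line_through X i j) \sum_(b in line_through X i j | b != a) g a b.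
Proof.
move=> /andP[ij]; set S := line_through X i j => S3.
pose q := #|[set a in S | live a]|; pose r := #|S|.
have qr : (q <= r)%N by apply/subset_leq_card/fintype.subsetP => a; rewrite inE => /andP[].
have sq : \sum_(a in S) (live a)%:R = q%:R :> C.
  rewrite -natr_sum; congr _%:R; rewrite /q -sum1_card.
  transitivity (\sum_(a in S | live a) 1)%N; last by apply: eq_bigl => a; rewrite inE.
  by rewrite big_mkcondr; apply: eq_bigr => a _; case: (live a).
have -> : \sum_(a in S) \sum_(b in S | b != a) (live a)%:R = (q * r.-1)%:R :> C.
  rewrite natrM -sq mulr_suml; apply: eq_bigr => a aS.
  rewrite sumr_const [RHS]mulr_natr; congr (_ *+ _).
  rewrite /r [in RHS](cardD1 a) aS /=; apply: eq_card => b; by rewrite -!topredE /= andbC.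
set E := \sum_(a in S) \sum_(b in S | b != a) g a b.
have E0 : 0 <= E by do 2![apply: sumr_ge0 => ? _].
(* Zeroing the rows outside [S] allows the Welch bound to be applied to the line without
   reindexing. *)
pose US : 'M[C]_(n, D') := \matrix_(a, k) (U a k *+ (a \in S)).
have FUS : frame_potential US = q%:R + E.
  rewrite -sq /E -big_split /frame_potential [RHS]big_mkcond /=.
  apply: eq_bigr => a _.
  have gUS b : `|(US *m US^t*) a b| ^+ 2 = if (a \in S) && (b \in S) then g a b else 0.
    have [/andP[aS bS]|nab] := boolP (_ && _).
      rewrite /g; congr (`| _ | ^+ 2); rewrite !mxE; apply: eq_bigr => k _.
      by rewrite !mxE aS bS.
    rewrite mxE big1 ?normr0 ?expr0n // => k _; rewrite !mxE.
    case/nandP: nab => /negPf ->; first by rewrite mulr0n mul0r.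
    by rewrite mulr0n rmorph0 mulr0.
  under eq_bigr => b _ do rewrite gUS.
  case: (boolP (a \in S)) => aS /=; last by rewrite big1.
  rewrite -big_mkcond (bigD1 a) //= g_diag; congr (_ + _).
have RUS : \sum_a rownorm US a = q%:R.
  rewrite -sq [RHS]big_mkcond; apply: eq_bigr => a _.
  case: ifP => aS; last by rewrite /rownorm big1 // => k _; rewrite mxE aS normr0 expr0n.
  by rewrite -rownormU; apply: eq_bigr => k _; rewrite mxE aS.
have sUS a b : a \in S -> b \in S -> a != b -> (US <= row a Y + row b Y)%MS.
  move=> aS bS ab; apply/row_subP => k.
  have -> : row k US = ((k \in S)%:R / sqrtC (rownorm Y k)) *: row k Y.
    apply/rowP => l; rewrite !mxE mulrAC -mulrA mulr_natl.
    by rewrite -mulrnAl.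
  have [kS|kS] := boolP (k \in S); last by rewrite mul0r scale0r sub0mx.
  apply: scalemx_sub.
  have : k \in line_through X a b by rewrite (line_through_eq indX ij ab aS bS).
  rewrite inE => h; rewrite !row_mul.
  by apply: submx_trans (submxMr A h) _; rewrite addsmxMr.
have rY a : (\rank (row a Y) <= live a)%N.
  rewrite /live; case: eqP => [->|_]; first by rewrite mxrank0.
  exact: rank_leq_row.
have rUS a b : a \in S -> b \in S -> a != b -> (\rank US <= live a + live b)%N.
  move=> aS bS ab; apply: leq_trans (mxrankS (sUS a b aS bS ab)) _.
  apply: leq_trans (mxrank_adds_leqif _ _).1 _; exact: leq_add.
have iS : i \in S := line_throughl X i j.
have jS : j \in S := line_throughr X i j.
have welch s : (\rank US <= s)%N -> (q ^ 2)%:R <= s%:R * (q%:R + E).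
  by move=> /sqr_sum_rownorm_le; rewrite RUS FUS natrX.
have [->|q0] := posnP q; first by rewrite mul0n mulr_ge0.
have [qrE|qnr] := eqVneq q r.
  have := welch 2 (leq_trans (rUS i j iS jS ij) (leq_add (leq_b1 _) (leq_b1 _))).
  have le1 : (q * r.-1 + 4 * q <= 2 * q ^ 2)%N.
    by move: S3; rewrite -/r -qrE; rewrite -mulnn; nia.
  move=> h; rewrite -(lerD2r (4 * q)%:R) -natrD.
  apply: (@le_trans _ _ (2 * q ^ 2)%:R); first by rewrite ler_nat.
  apply: (@le_trans _ _ (2 * (2 * (q%:R + E)))).
    by rewrite natrM; apply: ler_wpM2l.
  by rewrite le_eqVlt; apply/orP; left; apply/eqP; rewrite natrM; ring.
pose dead := [set a in S | ~~ live a].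
have qd : (q + #|dead| = r)%N.
  rewrite /q /r -(cardsID [set a | live a] S); congr (_ + _)%N.
    by apply: eq_card => a; rewrite !inE.
  by apply: eq_card => a; rewrite !inE andbC.
(* Two dead points span the plane of the line, so every point on it would die, against [q0]. *)
have dead1 : #|dead| = 1%N.
  apply/eqP; rewrite eqn_leq; apply/andP; split; last by move: qnr qd; lia.
  rewrite leqNgt; apply/negP => /card_gt1P[a [b [ha hb ab]]].
  move: ha; rewrite finset.in_set => /andP[aS /negPn/eqP a0].
  move: hb; rewrite finset.in_set => /andP[bS /negPn/eqP b0].
  move: q0; rewrite card_gt0 => /set0Pn[k]; rewrite finset.in_set => /andP[kS].
  have : k \in line_through X a b by rewrite (line_through_eq indX ij ab aS bS).
  rewrite inE => h; rewrite /live; apply/negP; rewrite negbK -submx0 row_mul.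
  by apply: submx_trans (submxMr A h) _; rewrite addsmxMr -!row_mul addsmx_sub a0 b0 !sub0mx.
have [a ha] : exists a, a \in dead by apply/set0Pn; rewrite -card_gt0 dead1.
move: ha; rewrite finset.in_set => /andP[aS /negPf la].
have [b bS ba] : exists2 b, b \in S & a != b.
  case: (eqVneq a i) => [->|ai]; first by exists j.
  by exists i.
have := welch 1%N; rewrite mul1r => /(_ _) h.
have := h (leq_trans (rUS a b aS bS ba) _); rewrite la leq_b1 => /(_ isT) {}h.
have qr1 : q = r.-1 by move: qd; rewrite dead1; lia.
have q2 : (2 <= q)%N by move: S3; rewrite -/r qr1; lia.
have le1 : (q * r.-1 + 4 * q <= 4 * q ^ 2)%N.
  by rewrite -qr1; rewrite -mulnn; nia.
rewrite -(lerD2r (4 * q)%:R) -natrD.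
apply: (@le_trans _ _ (4 * q ^ 2)%:R); first by rewrite ler_nat.
apply: (@le_trans _ _ (4 * (q%:R + E))).
  by rewrite natrM; apply: ler_wpM2l.
by rewrite le_eqVlt; apply/orP; left; apply/eqP; rewrite natrM; ring.
Qed.

End LineEnergy.

(** * Sparsest quotients *)

Definition live_rows (F : fieldType) n D (Y : 'M[F]_(n, D)) : {set 'I_n} :=
  [set i | row i Y != 0].

(* Among the quotients of the row space, one with the fewest surviving rows per dimension. *)
Lemma exists_sparsest_quotient (F : fieldType) n D (X : 'M[F]_(n, D)) :
  (0 < D)%N -> exists2 r, (0 < r)%N & exists Q : 'M[F]_(D, r),
  [/\ \rank Q = r, (#|live_rows (X *m Q)| * D <= n * r)%N &
   forall s (Q' : 'M[F]_(r, s)), (0 < s)%N -> \rank Q' = s ->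
     (#|live_rows (X *m Q)| * s <= #|live_rows (X *m Q *m Q')| * r)%N].
Proof.
move=> D0.
(* Descent on the dimension [r], with [m] as fuel: a quotient that violates minimality is replaced
   by its composite with a sparser one. *)
suff H m r (Q : 'M[F]_(D, r)) : (r <= m)%N -> (0 < r)%N -> \rank Q = r ->
    (#|live_rows (X *m Q)| * D <= n * r)%N ->
    exists2 r, (0 < r)%N & exists Q : 'M[F]_(D, r),
    [/\ \rank Q = r, (#|live_rows (X *m Q)| * D <= n * r)%N &
     forall s (Q' : 'M[F]_(r, s)), (0 < s)%N -> \rank Q' = s ->
       (#|live_rows (X *m Q)| * s <= #|live_rows (X *m Q *m Q')| * r)%N].
  apply: (H D D 1%:M) => //; first exact: mxrank1.
  rewrite leq_mul2r; apply/orP; right.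
  by have := max_card (mem (live_rows (X *m 1%:M))); rewrite card_ord.
elim: m r Q => [|m IH] r Q rm r0 rQ dQ; first by move: r0; rewrite ltnNge rm.
have [|nmin] := pselect (forall s (Q' : 'M[F]_(r, s)), (0 < s)%N -> \rank Q' = s ->
     (#|live_rows (X *m Q)| * s <= #|live_rows (X *m Q *m Q')| * r)%N).
  by move=> h; exists r => //; exists Q.
have [s [Q' [s0 rQ' lt]]] : exists s (Q' : 'M[F]_(r, s)), [/\ (0 < s)%N, \rank Q' = s &
     (#|live_rows (X *m Q *m Q')| * r < #|live_rows (X *m Q)| * s)%N].
  apply: contrapT => h; apply: nmin => s Q' s0 rQ'.
  by rewrite leqNgt; apply/negP => lt; apply: h; exists s, Q'.
have sr : (s <= r)%N by rewrite -rQ' rank_leq_row.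
(* For [s = r] the matrix [Q'] is injective and kills no row, so the density could not drop. *)
have sr' : (s < r)%N.
  rewrite ltn_neqAle sr andbT; apply: contraTneq lt => e; subst s.
  rewrite -leqNgt leq_mul2r; apply/orP; right; apply: subset_leq_card.
  apply/fintype.subsetP => i; rewrite !inE; apply: contraNneq => e.
  have fQ' : row_free Q' by rewrite /row_free rQ'.
  by rewrite -(mulmx_free_eq0 _ fQ') -row_mul e.
apply: (IH s (Q *m Q')) => //; first by move: rm sr'; lia.
- have fQ' : row_full Q' by rewrite /row_full rQ'.
  have fQ : row_full Q by rewrite /row_full rQ.
  by rewrite (eqmxMfull Q' fQ) rQ'.
rewrite mulmxA; move: lt dQ.
set a := #|_|; set b := #|_| => lt dQ; move: lt dQ r0 s0; clear; nia.
Qed.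

(** * The counting bound for special pairs *)

Section KeyBound.
Variables (R : realType) (n D : nat) (X : 'M[R[i]]_(n, D)).

Lemma special_pairs_bound (k : nat) :
  (0 < n)%N -> (0 < D)%N -> row_full X -> pairwise_independent X ->
  (forall i, k <= #|[set j | special_pair X i j]|)%N ->
  (D * (k + 4) <= 8 * n)%N.
Proof.
move=> n0 D0 fX indX hk.
have [r r0 [Q [rQ dQ minQ]]] := exists_sparsest_quotient X D0.
set A := live_rows (X *m Q) in dQ minQ.
set N := #|A| in dQ minQ.
pose V : 'M[R[i]]_(N, r) := rowsub (fun k : 'I_N => enum_val k) (X *m Q).
have rowV (j : 'I_N) : row j V = row (enum_val j) (X *m Q) by apply/rowP => l; rewrite !mxE.
have V0 (j : 'I_N) : row j V != 0.
  by rewrite rowV; have := enum_valP j; rewrite inE.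
have fXQ : row_full (X *m Q).
  by rewrite /row_full (eqmxMfull Q fX) rQ.
have fV : row_full V.
  rewrite -sub1mx; apply: submx_trans (_ : (X *m Q <= V)%MS); first by rewrite sub1mx.
  apply/row_subP => i; have [iA|] := boolP (i \in A); last first.
    by rewrite inE negbK => /eqP->; rewrite sub0mx.
  by rewrite -(enum_rankK_in iA iA) -rowV row_sub.
have N0 : (0 < N)%N.
  rewrite lt0n; apply/eqP => N0; move: fV; rewrite /row_full.
  have := rank_leq_row V; rewrite {2}N0 leqn0 => /eqP ->; rewrite eq_sym.
  by move: r0; case: (r).
(* Minimality is tested on the further quotient by the span [M] of the rows in [s], of dimension
   [r - \rank M]. All rows in [s] die there, so at most [N - size s] survive. *)
have dens (s : seq 'I_N) : uniq s -> (size s * r <= N * \rank (row_span V s))%N.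
  move=> us; set M := row_span V s.
  have sN : (size s <= N)%N by have := max_card (mem s); rewrite card_ord (card_uniqP us).
  have rM : (\rank M <= r)%N by exact: rank_leq_row.
  set t := \rank (cokermx M).
  have tE : t = (r - \rank M)%N by rewrite /t mxrank_coker.
  have [t0|t0] := posnP t.
    by have -> : \rank M = r; [move: t0 tE rM; lia | rewrite leq_mul2r sN orbT].
  have := minQ t (col_base (cokermx M)) t0 (eqP (col_base_full _)).
  set N' := #|_| => le.
  have N's : (N' + size s <= N)%N.
    pose s' := [seq enum_val j | j <- s].
    have us' : uniq s' by rewrite map_inj_uniq //; exact: enum_val_inj.
    rewrite -(size_map (fun j : 'I_N => enum_val j) s) -(card_uniqP us').
    rewrite /N -(cardsID [set i | i \in s'] A) addnC; apply: leq_add.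
      apply: subset_leq_card; apply/fintype.subsetP => i is'.
      rewrite !inE is' andbT.
      by move/mapP: is' => [j _ ->]; have := enum_valP j; rewrite inE.
    apply: subset_leq_card; apply/fintype.subsetP => i; rewrite inE => hi.
    rewrite !inE; apply/andP; split; last first.
      by apply: contraNneq hi => e; rewrite row_mul e mul0mx.
    apply: contraNN hi => /mapP[j js ->]; rewrite row_mul -rowV.
    have : (row j V <= M)%MS.
      rewrite /M /row_span (big_rem j) //=.
      by apply: submx_trans (addsmxSl _ _); rewrite genmxE.
    rewrite submxE -{1}(mulmx_base (cokermx M)) mulmxA => /eqP e.
    by rewrite -(mulmx_free_eq0 _ (row_base_free (cokermx M))) e.
  move: le N's tE rM r0; clear; nia.
have [T uT hT] := near_isotropic N0 r0 fV V0 dens.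
(* [Y] has the rows of [V *m T] but keeps the dead ones, so that its rows are still indexed like the
   points. *)
pose Y := X *m (Q *m T).
have liveY i : (row i Y != 0) = (i \in A).
  rewrite inE /Y mulmxA [row i (_ *m T)]row_mul; congr (~~ _).
  apply/eqP/eqP => [e|->]; last by rewrite mul0mx.
  by rewrite -(mulmxK uT (row i (X *m Q))) e mul0mx.
pose U := unit_rows Y.
have FU : frame_potential U <= 2 * N%:R ^+ 2 / r%:R.
  apply: le_trans hT; rewrite le_eqVlt; apply/orP; left; apply/eqP.
  rewrite -(@frame_potential_live _ _ _ U A) => [|i]; last first.
    rewrite -liveY negbK => /eqP/rowP Y0; apply/rowP => l.
    by have := Y0 l; rewrite !mxE => ->; rewrite mul0r.
  congr frame_potential; apply/matrixP => i l.
  have e m : (V *m T) i m = Y (enum_val i) m.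
    by rewrite /Y mulmxA !mxE; apply: eq_bigr => j _; rewrite !mxE.
  rewrite [LHS]mxE [LHS]mxE [RHS]mxE e; congr (_ / sqrtC _).
  by apply: eq_bigr => m _; rewrite e.
pose g i j : R[i] := `|(U *m U^t*) i j| ^+ 2.
have h : (N * k)%:R <= 4 * (frame_potential U - N%:R).
  have hs : \sum_(p | special_pair X p.1 p.2) (row p.1 Y != 0)%:R
      <= 4 * \sum_(p | special_pair X p.1 p.2) g p.1 p.2.
    pose line p := line_through X p.1 p.2.
    rewrite (partition_big line predT) //= [in leRHS](partition_big line predT) //=.
    rewrite mulr_sumr; apply: ler_sum => S _.
    have [[i j] /andP[sp /eqP eS]|no] :=
      pickP (fun p => special_pair X p.1 p.2 && (line p == S)); last first.
      by rewrite !big_pred0 // mulr0.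
    rewrite !(sum_special_pair indX _ sp eS) /= -eS.
    exact: (line_energy (Q *m T) indX sp).
  have hN : (N * k)%:R <= \sum_(p | special_pair X p.1 p.2) (row p.1 Y != 0)%:R :> R[i].
    rewrite -natr_sum ler_nat.
    rewrite -(pair_big_dep xpredT (special_pair X)
      (fun i _ => nat_of_bool (row i Y != 0))) /=.
    rewrite -sum_nat_const big_mkcond; apply: leq_sum => i _.
    rewrite liveY; case: ifP => // iA; rewrite sum1_card.
    apply: leq_trans (hk i) _; apply/subset_leq_card/fintype.subsetP => j.
    by rewrite inE.
  apply: le_trans hN (le_trans hs _); apply: ler_wpM2l => //.
  (* The diagonal entries of [g] sum to [N], and special pairs lie off the diagonal. *)
  rewrite lerBrDl.
  have -> : N%:R = \sum_i g i i.
    rewrite /N -sum1_card natr_sum big_mkcond; apply: eq_bigr => i _.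
    rewrite /g rownorm_diag -liveY; case: ifPn => [Yi|/negPn/eqP Yi].
      by rewrite rownorm_unit_rows // normr1 expr1n.
    rewrite /rownorm big1 ?normr0 ?expr0n // => l _.
    by move/rowP/(_ l): Yi; rewrite !mxE => ->; rewrite mul0r normr0 expr0n.
  rewrite -(pair_big_dep xpredT (special_pair X) g) /= -big_split /=.
  apply: ler_sum => i _; rewrite [leRHS](bigD1 i) //=; apply: lerD => //.
  rewrite big_mkcond [leRHS]big_mkcond; apply: ler_sum => j _ /=.
  rewrite /special_pair eq_sym; case: (j != i) => /=; last by [].
  by case: ifP => // _; rewrite exprn_ge0.
have h2 : (N * (k + 4))%:R * r%:R <= 8 * N%:R ^+ 2 :> R[i].
  have r0' : 0 < r%:R :> R[i] by rewrite ltr0n.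
  rewrite -ler_pdivlMr // mulnDr natrD.
  apply: (le_trans (lerD h (lexx _))).
  have -> : 4 * (frame_potential U - N%:R) + (N * 4)%:R = 4 * frame_potential U.
    by rewrite natrM; ring.
  apply: (@le_trans _ _ (4 * (2 * N%:R ^+ 2 / r%:R))); first exact: ler_wpM2l.
  by rewrite le_eqVlt; apply/orP; left; apply/eqP; rewrite !mulrA -natrM.
have h3 : (r * (k + 4) <= 8 * N)%N.
  move: h2; rewrite -natrX -!natrM ler_nat; move: N0; clear; nia.
(* Multiplying [h3] by [D] and inserting [N * D <= n * r] lets [r] cancel. *)
move: h3 dQ r0; clear; nia.
Qed.

End KeyBound.

(** With no points to contain, a smallest subspace would lie inside its own base point; if none
    exists, [xget] returns its default 0. *)
Lemma config_dim0 (K : fieldType) (V : vectType K) n (v : 'I_n -> V) :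
  n = 0%N -> config_dim v = 0%N.
Proof.
move=> n0; subst n.
rewrite /config_dim; case: xgetP => [k _ [A [_ mA] <-]|//].
apply/eqP; rewrite -leqn0.
have /sub_affine_dim : {subset A <= AffineSubspace (base A) 0%VS} by apply: mA => -[].
by rewrite /affine_dim /= dimv0.
Qed.

(** * Homogeneous coordinates *)

Section Homogeneous.
Variables (K : fieldType) (d n : nat) (v : 'I_n -> 'rV[K]_d).

Definition homogeneous_mx : 'M[K]_(n, d + 1) :=
  \matrix_i row_mx (v i) (const_mx 1).

(** All differences of points lie in the linear span of the points, a projection of the homogeneous
    row space. For [n > 0] the exact value is one less than the rank, a loss that the final
    constants absorb. *)
Lemma config_dim_le_rank : (config_dim v <= \rank homogeneous_mx)%N.
Proof.
have [n0|n0] := posnP n; first by rewrite config_dim0.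
rewrite (config_dim_span v (Ordinal n0)); set i0 := Ordinal n0.
pose W : 'M[K]_(n, d) := \matrix_i v i.
have WE : W = homogeneous_mx *m col_mx 1%:M 0.
  apply/row_matrixP => i; rewrite row_mul !rowK mul_row_col mulmx1 mulmx0 addr0 //.
apply: (@leq_trans (\rank W)); last by rewrite WE mxrankM_maxl.
pose B := [seq row l (row_base W) | l : 'I_(\rank W)].
have sB : size B = \rank W by rewrite size_map size_enum_ord.
rewrite -{}sB; apply: leq_trans (dim_span B); apply: dimvS.
have wB i : v i \in <<B>>%VS.
  have -> : v i = row i W by rewrite rowK.
  rewrite -{1}(mulmx_base W) row_mul mulmx_sum_row; apply: memv_suml => l _.
  by apply: memvZ; apply: memv_span; apply: codom_f.
apply/span_subvP => y /(@codomP _ _ (fun j => v j - v i0))[i ->].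
exact: memvB.
Qed.

Lemma row_homogeneous i : row i homogeneous_mx = row_mx (v i) (const_mx 1).
Proof. exact: rowK. Qed.

Lemma row_homogeneous_neq0 i : row i homogeneous_mx != 0.
Proof.
rewrite row_homogeneous; apply/eqP => /(congr1 (@rsubmx _ _ _ _)).
by rewrite row_mxKr => /matrixP/(_ 0 0)/eqP; rewrite !mxE oner_eq0.
Qed.

(** Proportional vectors with last coordinate 1 are equal. *)
Lemma homogeneous_independent : injective v -> pairwise_independent homogeneous_mx.
Proof.
move=> vinj i j ij; set H := homogeneous_mx.
have r1 k : \rank (row k H) = 1%N by rewrite rank_rV row_homogeneous_neq0.
apply/eqP; rewrite eqn_leq; apply/andP; split.
  by apply: leq_trans (mxrank_adds_leqif _ _).1 _; rewrite !r1.
rewrite ltnNge; apply: contraNN ij => h.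
have sub : (row i H + row j H <= row i H)%MS.
  have [le <-] := mxrank_leqif_sup (addsmxSl (row i H) (row j H)).
  by rewrite eqn_leq le r1.
have /sub_rVP[c e] := submx_trans (addsmxSr (row i H) (row j H)) sub.
move: e; rewrite !row_homogeneous scale_row_mx => /eq_row_mx[ve ce].
have c1 : c = 1.
  by move/matrixP/(_ 0 0): ce; rewrite !mxE mulr1 => ->.
by apply/eqP/vinj; rewrite ve c1 scale1r.
Qed.

Lemma special_line_pair (l : affine_subspace 'rV[K]_d) i j : injective v ->
  special_line v l -> v i \in l -> v j \in l -> j != i ->
  special_pair homogeneous_mx i j.
Proof.
move=> vinj [l1 l3] il jl ji; rewrite /special_pair eq_sym ji /=.
apply: leq_trans l3 _; apply: subset_leq_card; apply/fintype.subsetP => k.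
rewrite inE => kl; rewrite inE.
have u k' : v k' \in l -> v k' - v i \in direction l.
  by move=> k'l; have := memvB k'l il; rewrite opprB addrA subrK.
have u0 : v j - v i != 0 by rewrite subr_eq0; apply: contraNneq ji => /vinj ->.
have dirE : (<[v j - v i]> == direction l)%VS.
  by rewrite eqEdim -memvE u //= -/(affine_dim l) l1 dim_vline u0.
have := u k kl; rewrite -(eqP dirE) => /vlineP[c ce].
(* The coefficients add up to 1, as the last homogeneous coordinate demands. *)
have -> : row k homogeneous_mx =
    (1 - c) *: row i homogeneous_mx + c *: row j homogeneous_mx.
  rewrite !row_homogeneous !scale_row_mx add_row_mx; congr row_mx.
    rewrite -(subrK (v i) (v k)) ce scalerBr scalerBl scale1r addrC.
    by rewrite -!addrA; congr (_ + _); rewrite addrC.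
  by apply/matrixP => a b; rewrite !mxE !mulr1 subrK.
apply: addmx_sub; apply: scalemx_sub; [exact: addsmxSl | exact: addsmxSr].
Qed.

End Homogeneous.

(** * Invariance of lines under injective linear maps *)

Section RowFreeFactor.
Variables (F : fieldType) (n D m : nat) (X : 'M[F]_(n, D)) (B : 'M[F]_(D, m)).
Hypothesis fB : row_free B.

Lemma special_pair_mulmx_free i j : special_pair (X *m B) i j = special_pair X i j.
Proof.
rewrite /special_pair (_ : line_through (X *m B) i j = line_through X i j) //.
by apply/setP => k; rewrite !inE !row_mul -(addsmxMr _ _ B) submxMfree.
Qed.

Lemma pairwise_independent_mulmx_free :
  pairwise_independent (X *m B) -> pairwise_independent X.
Proof.
move=> h i j ij; rewrite -(h i j ij) !row_mul -(addsmxMr _ _ B).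
by rewrite mxrankMfree.
Qed.

End RowFreeFactor.

Lemma SG_rank_bound (R : realType) (delta : R) (d n : nat) (v : 'I_n -> 'rV[R[i]]_d) :
  (0 < n)%N -> SG_configuration delta v -> (config_dim v)%:R * delta <= 8.
Proof.
move=> n0 [vinj sg].
set H := homogeneous_mx v; set D := \rank H.
have [D0|D0] := posnP D.
  have := config_dim_le_rank v; rewrite -/H -/D D0 leqn0 => /eqP ->.
  by rewrite mul0r.
have fB : row_free (row_base H) := row_base_free H.
(* Coordinates in a basis of the row space of [H] provide the full column rank required by
   [special_pairs_bound]. *)
pose X := col_base H.
have HE : X *m row_base H = H := mulmx_base H.
have indX : pairwise_independent X.
  apply: (pairwise_independent_mulmx_free fB); rewrite HE.
  exact: homogeneous_independent.
have spE i j : special_pair X i j = special_pair H i j.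
  by rewrite -(special_pair_mulmx_free _ fB) HE.
pose m i := #|[set j | special_pair X i j]|.
(* The successor accounts for [v i] itself, which lies on its own special lines but forms no pair
   with itself. *)
have hm i : delta * n%:R <= (m i).+1%:R.
  have [L [hL le]] := sg i; apply: le_trans le _; rewrite ler_nat.
  apply: (@leq_trans #|i |: [set j | special_pair X i j]|); last first.
    by rewrite cardsU1 -[(m i).+1]add1n leq_add2r leq_b1.
  apply: subset_leq_card.
  apply/fintype.subsetP => j; rewrite inE => /asboolP[l Ll jl]; rewrite !inE.
  have [sl il] := hL l Ll.
  case: eqP => //= /eqP ji; rewrite spE; exact: special_line_pair sl il jl ji.
pose i0 := Ordinal n0.
pose i1 := [arg min_(i < i0) m i].
have hi1 i : (m i1 <= m i)%N.
  by rewrite /i1; case: arg_minnP => // a _; apply.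
have key : (D * (m i1 + 4) <= 8 * n)%N.
  exact: special_pairs_bound n0 D0 (col_base_full H) indX hi1.
have hd : (config_dim v)%:R <= D%:R :> R by rewrite ler_nat config_dim_le_rank.
have n0' : 0 < n%:R :> R by rewrite ltr0n.
have keyR : D%:R * ((m i1)%:R + 4) <= 8 * n%:R :> R.
  by rewrite -natrD -!natrM ler_nat.
have h1 := hm i1; rewrite -natr1 in h1.
have D0' : 0 <= D%:R :> R by rewrite ler0n.
have [dl|dl] := leP delta 0.
  by apply: (@le_trans _ _ 0) => //; rewrite mulr_ge0_le0.
rewrite -(ler_pM2r n0').
(* Here [delta * n <= m i1 + 1 <= m i1 + 4]. *)
apply: le_trans keyR; rewrite -mulrA; apply: ler_pM => //.
  by rewrite mulr_ge0 // ltW.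
by apply: le_trans h1 _; rewrite lerD2l ler1n.
Qed.

Theorem theorem4p3 (R : realType) :
  (forall (delta : R) (d n : nat) (v : 'I_n -> 'rV[R[i]]_d),
     0 < delta -> delta <= 1 -> SG_configuration delta v ->
     (config_dim v)%:R < 13 / delta ^+ 2) /\
  (forall (d n : nat) (v : 'I_n -> 'rV[R[i]]_d),
     SG_configuration 1 v -> (config_dim v <= 10)%N).
Proof.
split=> [delta d n v d0 d1 sg|d [|n] v sg].
- have d2 : 0 < delta ^+ 2 by rewrite exprn_gt0.
  rewrite ltr_pdivlMr //.
  case: n v sg => [|n] v sg; first by rewrite config_dim0 // mul0r.
  have := SG_rank_bound (ltn0Sn n) sg => h.
  (* The linear bound is stronger than the quadratic one: [8 * delta <= 8 < 13] as [delta <= 1]. *)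
  rewrite expr2 mulrA; apply: (@le_lt_trans _ _ (8 * delta)).
    by rewrite ler_pM2r.
  by nra.
- by rewrite config_dim0.
have := SG_rank_bound (ltn0Sn n) sg; rewrite mulr1 ler_nat => h.
exact: leq_trans h _.
Qed.
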